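(* Let $P\le\mathrm{Sym}(\Omega)$ be a permutation group, where neither $P$ nor $\Omega$ is assumed to be finite. Let $c$ be a positive integer, and suppose $\mathrm{supp}(\sigma)\le c$ for all $\sigma\in P$. Then (1) $|P|\le c!$; (2) $\mathrm{supp}(P)\le 2(c-1)$ if $c>1$.
   Context: For a permutation group $P\le\mathrm{Sym}(\Omega)$ and $\sigma\in P$, $\mathrm{supp}(\sigma)$ denotes the number of points of $\Omega$ moved by $\sigma$, and $\mathrm{supp}(P)$ denotes the number of points of $\Omega$ moved by some element of $P$. *)

(* Defs.v *)
From HB Require Import structures.
From mathcomp Require Import all_boot.
From mathcomp Require Import boolp classical_sets functions cardinality.

Set Implicit Arguments.
Unset Strict Implicit.
Unset Printing Implicit Defensive.

Local Open Scope group_scope.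
Local Open Scope classical_set_scope.

(* The inverse is carried as data, but it is determined by the function: two
   permutations are equal as soon as they agree pointwise, see sym_eqP below. *)
Record Sym (Omega : Type) := MkSym {
  sym_fun :> Omega -> Omega;
  sym_inv : Omega -> Omega;
  sym_funK : cancel sym_fun sym_inv;
  sym_invK : cancel sym_inv sym_fun }.

Section SymGroup.
Variable Omega : Type.
Implicit Types s t u : Sym Omega.

Lemma sym_eqP s t : s = t <-> s =1 t.
Proof.
split=> [->//|]; case: s t => [f f' fK f'K] [g g' gK g'K] /= /funext fg.
case: _ / fg gK g'K => gK g'K.
have fg' : f' = g' by apply/funext => x; rewrite -{1}(g'K x) fK.
case: _ / fg' gK g'K => gK g'K.
by rewrite (Prop_irrelevance fK gK) (Prop_irrelevance f'K g'K).
Qed.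

HB.instance Definition _ := gen_eqMixin (Sym Omega).
HB.instance Definition _ := gen_choiceMixin (Sym Omega).

Definition sym_one : Sym Omega := @MkSym Omega id id (frefl _) (frefl _).

Definition sym_opp s : Sym Omega := MkSym (sym_invK s) (sym_funK s).

(* Permutations act on the right, as for {perm T}: (s * t) x = t (s x). *)
Definition sym_mul s t : Sym Omega :=
  MkSym (can_comp (sym_funK t) (sym_funK s))
        (can_comp (sym_invK s) (sym_invK t)).

Fact sym_mulA : associative sym_mul. Proof. by move=> s t u; apply/sym_eqP. Qed.
Fact sym_mul1 : left_id sym_one sym_mul. Proof. by move=> s; apply/sym_eqP. Qed.
Fact sym_mulr1 : right_id sym_one sym_mul.
Proof. by move=> s; apply/sym_eqP. Qed.
Fact sym_mulV : left_inverse sym_one sym_opp sym_mul.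
Proof. by move=> s; apply/sym_eqP => x /=; rewrite sym_invK. Qed.
Fact sym_mulrV : right_inverse sym_one sym_opp sym_mul.
Proof. by move=> s; apply/sym_eqP => x /=; rewrite sym_funK. Qed.

HB.instance Definition _ := isGroup.Build (Sym Omega)
  sym_mulA sym_mul1 sym_mulr1 sym_mulV sym_mulrV.

Definition supp s : set Omega := [set x | s x <> x].

Definition gsupp (P : set (Sym Omega)) : set Omega :=
  [set x | exists2 s, P s & s x <> x].

End SymGroup.

(* Main.v *)
From mathcomp Require Import all_boot all_fingroup zify.
Require Import Defs.
From HB Require Import structures.
From mathcomp Require Import boolp classical_sets functions cardinality.

(** When the support of P is finite, P acts on a finite set T with a set D of
    orbits. By Burnside's orbit-counting lemma the average number of points
    moved by an element of P is n - k, with n = #|T| and k = #|D|; since the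
    identity moves nothing, n - k < c. A nontrivial orbit A has
    #|A| <= 2 (#|A| - 1), and summing over orbits bounds the support by
    2 (n - k). Moreover P embeds into the product of the symmetric groups of
    its orbits, so #|P| <= \prod_A #|A|! <= (1 + \sum_A (#|A| - 1))! <= c!,
    using (m+1)! (n+1)! <= (m+n+1)!.

    In general, a finite set of points moved by P is moved by finitely many
    elements of P, whose supports have a finite union X. The subgroup of the
    elements of P with support inside X has finite support, so the finite case
    bounds the cardinality of the given set of points. Hence P itself has finite
    support. *)

(** * Products of factorials, and partitions of a finite set *)

Lemma leq_fact_mulSS (m n : nat) : m.+1`! * n.+1`! <= (m + n).+1`!.
Proof.
elim: n => [|n IHn]; first by rewrite addn0 muln1.
rewrite addnS [n.+2`!]factS [(m + n).+2`!]factS mulnCA.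
by apply: leq_mul => //; lia.
Qed.

Lemma leq_prod_factS (I : Type) (r : seq I) (Q : pred I) (F : I -> nat) :
  \prod_(i <- r | Q i) (F i).+1`! <= (\sum_(i <- r | Q i) F i).+1`!.
Proof.
elim/big_rec2: _ => // i n m _ le_mn.
by apply: leq_trans _ (leq_fact_mulSS _ _); rewrite leq_mul2l le_mn orbT.
Qed.

(** Blocks are nonempty, so each predecessor loses exactly one. For orbits this identifies the sum
    with n - k. *)
Lemma sum_predn_partition (T : finType) (D : {set {set T}}) :
  finset.partition D [set: T] ->
  (\sum_(A in D) #|A|.-1) + #|D| = #|T|.
Proof.
move=> partD; rewrite -cardsT (card_partition partD) -sum1_card -big_split /=.
apply: eq_bigr => A DA; rewrite addn1 prednK // card_gt0.
by apply: contraTneq DA => ->; case/and3P: partD.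
Qed.

(** A permutation preserving every block is determined by its restrictions to the blocks. *)
Lemma leq_card_stab_partition (T : finType) (G : {set {perm T}})
    (D : {set {set T}}) :
    finset.partition D [set: T] ->
    {in D, forall A : {set T}, G \subset 'N(A | 'P)%g} ->
  #|G| <= \prod_(A in D) (#|A|)`!.
Proof.
move=> partD stabD.
(* The default 1 outside [D] places [res p] in the [pfamily] counted below. *)
pose res (p : {perm T}) : {ffun {set T} -> {perm T}} :=
  [ffun A => if A \in D then restr_perm A p else 1%g].
have res_inj : {in G &, injective res}.
  move=> p q Gp Gq /ffunP eq_pq; apply/permP => x.
  have: x \in finset.cover D by rewrite (cover_partition partD) inE.
  case/bigcupP => A DA Ax; have sGA := fintype.subsetP (stabD A DA).
  have := eq_pq A; rewrite !ffunE DA => /permP/(_ x).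
  by rewrite !restr_permE ?sGA.
rewrite -(card_in_imset res_inj).
under eq_bigr => A _ do rewrite -card_perm.
apply: leq_trans (_ : #|pfamily 1%g D (fun A => perm_on A)| <= _); last first.
  by rewrite card_pfamily foldrE big_map big_enum.
apply/subset_leq_card/fintype.subsetP => _ /imsetP[p _ ->].
apply/pfamilyP; split.
  by apply/supportP => A /negPf D'A; rewrite ffunE D'A.
by move=> A DA; rewrite ffunE DA; apply: restr_perm_on.
Qed.

(** * Orbit counting for finite permutation groups *)

Section FinitePermGroup.
Variables (T : finType) (G : {group {perm T}}).

Let D : {set {set T}} := [set orbit 'P G x | x in [set: T]].

Lemma perm_acts_setT : [acts G, on [set: T] | 'P].
Proof. by apply/actsP => p _ x; rewrite !inE. Qed.

Lemma perm_orbit_partition : finset.partition D [set: T].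
Proof. exact/orbit_partition/perm_acts_setT. Qed.

Lemma sum_card_moved :
  \sum_(p in G) #|[set x | p x != x]| + #|D| * #|G| = #|T| * #|G|.
Proof.
rewrite -(Frobenius_Cauchy perm_acts_setT) -big_split /= mulnC -sum_nat_const.
apply: eq_bigr => p _; rewrite -(cardsC [set x | p x != x]); congr addn.
by apply: eq_card => x; rewrite !inE negbK finset.sub1set inE.
Qed.

Lemma card_ltn_orbits (c : nat) :
    0 < c -> {in G, forall p : {perm T}, #|[set x | p x != x]| <= c} ->
  #|T| < #|D| + c.
Proof.
move=> c_gt0 moved_le; have G_gt0 := cardG_gt0 G.
rewrite -(ltn_pmul2r G_gt0) -sum_card_moved addnC mulnDl ltn_add2l.
(* Splitting off the identity, which moves nothing, makes the inequality strict: at most [c] for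
   each other element, against [c] for every element of [G]. *)
rewrite (bigD1 1%g) //= eq_card0 ?add0n; last first.
  by move=> x; rewrite inE perm1 eqxx.
rewrite (@leq_ltn_trans (\sum_(p in G | p != 1%g) c)) //.
  by apply: leq_sum => p /andP[/moved_le].
rewrite [ltnRHS]mulnC -sum_nat_const [ltnRHS](bigD1 1%g) //=.
by rewrite -addn1 addnC leq_add2r.
Qed.

Lemma leq_card_moved :
  #|[set x | [exists p in G, p x != x]]| <= 2 * \sum_(A in D) #|A|.-1.
Proof.
rewrite big_distrr -sum1_card.
rewrite (eq_bigl (fun x => (x \in [set: T]) && [exists p in G, p x != x]));
  last by move=> x; rewrite !inE.
rewrite (set_partition_big_cond _ perm_orbit_partition) /=.
(* An orbit with one point contributes no moved point; a larger one satisfies #|A| <= 2 (#|A| -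
   1). *)
apply: leq_sum => A DA; have [A1|A1] := leqP #|A| 1.
  rewrite big1 // => x /andP[Ax /existsP[p /andP[Gp]]].
  case/imsetP: DA Ax A1 => y _ ->; rewrite -orbit_eq_mem.
  move=> /eqP<- /card_le1_eqP le1.
  by rewrite (le1 x (p x)) ?eqxx ?orbit_refl //; apply: (mem_orbit 'P x Gp).
apply: (@leq_trans #|A|); last lia.
rewrite -sum1_card [leqRHS](bigID [pred x | [exists p in G, p x != x]]).
exact: leq_addr.
Qed.

Lemma leq_card_fact : #|G| <= (\sum_(A in D) #|A|.-1).+1`!.
Proof.
apply: leq_trans _ (leq_prod_factS _ _ _ _).
apply: leq_trans (leq_card_stab_partition _ _ _ perm_orbit_partition _) _.
  move=> _ /imsetP[x _ ->]; apply/actsP => p Gp y.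
  exact/orbit_actr.
rewrite leq_eqVlt; apply/orP; left; apply/eqP/eq_bigr => _ /imsetP[x _ ->].
by rewrite prednK // card_gt0; apply/set0Pn; exists x; apply: orbit_refl.
Qed.

Lemma finite_perm_bound (c : nat) :
    0 < c -> {in G, forall p : {perm T}, #|[set x | p x != x]| <= c} ->
  #|G| <= c`! /\ #|[set x | [exists p in G, p x != x]]| <= 2 * (c - 1).
Proof.
move=> c_gt0 /(card_ltn_orbits c c_gt0).
have := leq_card_moved; have := leq_card_fact.
rewrite -(sum_predn_partition _ _ perm_orbit_partition) addnC ltn_add2l.
move: (\sum_(A in D) _) => n leG leM lt_nc; split; last lia.
by apply: leq_trans leG _; apply: leq_fact.
Qed.

End FinitePermGroup.

(** * Comparing finite cardinals with classical ones *)

Local Open Scope classical_set_scope.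
Local Open Scope card_scope.

Lemma card_eq_finset (T : finType) (B : {set T}) : [set` B] #= `I_#|B|.
Proof.
apply/card_set_bijP; exists (fun x => index x (enum B)); split.
- by move=> x /= Bx; rewrite cardE index_mem mem_enum.
- move=> x y; rewrite !in_setE /= => Bx By eq_xy.
  by apply: (index_inj x) eq_xy; rewrite mem_enum.
- move=> n /= lt_n; exists (enum_val (Ordinal lt_n)); first exact: enum_valP.
  by rewrite /enum_val index_uniq ?enum_uniq // -cardE.
Qed.

Lemma leq_card_finset (T : finType) (U : Type) (f : T -> U) (B : {set T})
    (Y : set U) (n : nat) :
  injective f -> {in B, forall x, Y (f x)} -> Y #<= `I_n -> #|B| <= n.
Proof.
move=> f_inj BY Yn; rewrite -card_le_II -(card_le_eql (card_eq_finset T B)).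
apply: card_le_trans Yn; have [|g] := (injfunPex (A := [set` B]) (B := Y)).2.
  by exists f => // x y _ _ /f_inj.
exact: inj_card_le.
Qed.

Lemma card_le_finset (T : finType) (U : Type) (f : U -> T) (B : {set T})
    (Y : set U) (n : nat) :
    set_inj Y f -> (forall x, Y x -> f x \in B) -> #|B| <= n -> Y #<= `I_n.
Proof.
move=> f_inj YB Bn; have [|g] := (injfunPex (A := Y) (B := [set` B])).2.
  by exists f.
apply: (card_le_trans (inj_card_le g)).
by rewrite (card_le_eql (card_eq_finset T B)) card_le_II.
Qed.

(** * Permutation groups with finite support *)

Section SymSupport.
Variables (Omega : Type) (P : set (Sym Omega)).
Hypothesis P_group : group_closed [in P].

Lemma sym_group1 : P 1%g.
Proof. by case: P_group => /set_mem. Qed.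

Lemma sym_groupM (g h : Sym Omega) : P g -> P h -> P (g * h)%g.
Proof.
have [/set_mem P1 Pdiv] := P_group; move=> Pg Ph.
have Pinv : P h^-1%g.
  by rewrite -[h^-1%g]mul1g; apply/set_mem/Pdiv; apply/mem_set.
by rewrite -[h]invgK; apply/set_mem/Pdiv; apply/mem_set.
Qed.

(** If [g] moves [x], then by injectivity it also moves [g x]. Hence [P] acts on its support. *)
Lemma gsupp_sym_fun (g : Sym Omega) (x : Omega) :
  P g -> gsupp P x -> gsupp P (g x).
Proof.
move=> Pg Px; have [<-//|gx_neq] := pselect (x = g x).
by exists g => // /(can_inj (sym_funK g)) /esym.
Qed.

Lemma gsupp_fixed (g : Sym Omega) (x : Omega) : P g -> ~ gsupp P x -> g x = x.
Proof. by move=> Pg; apply: contra_notP => gx; exists g. Qed.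

End SymSupport.

Lemma finite_gsupp_bound (Omega : Type) (P : set (Sym Omega)) (c : nat) :
    group_closed [in P] -> finite_set (gsupp P) -> 0 < c ->
    (forall g : Sym Omega, P g -> supp g #<= `I_c) ->
  P #<= `I_(c`!) /\ gsupp P #<= `I_(2 * (c - 1)).
Proof.
(* With a choice structure on [Omega], the sequence listing the support becomes a finite type. *)
elim/Pchoice: Omega P => Omega P P_group /finite_seqP[s supp_s] c_gt0 suppP.
have mem_s x : gsupp P x <-> x \in s by rewrite supp_s.
pose T : finType := seq_sub s.
pose acts_as (p : {perm T}) (g : Sym Omega) := forall x, val (p x) = g (val x).
have acts_exists g : P g -> exists p, acts_as p g.
  move=> Pg; have gs (x : T) : g (val x) \in s.
    exact/mem_s/gsupp_sym_fun/mem_s/valP.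
  have g_inj : injective (fun x : T => Sub (g (val x)) (gs x) : T).
    by move=> x y /(congr1 val) /= /(can_inj (sym_funK g)) /val_inj.
  by exists (perm g_inj) => x; rewrite permE.
(* [G] is the group of permutations that [P] induces on its support. *)
pose G := ([set p : {perm T} | `[< exists2 g, P g & acts_as p g >]])%SET.
have GP p : p \in G <-> exists2 g, P g & acts_as p g.
  by rewrite inE; split=> /asboolP.
have G_group : group_set G.
  apply/group_setP; split.
    by apply/GP; exists 1%g; [apply: sym_group1 | move=> x; rewrite perm1].
  move=> p q /GP[g Pg pg] /GP[h Ph qh]; apply/GP; exists (g * h)%g.
    exact: sym_groupM.
  by move=> x; rewrite permM qh pg.
have movedE p g x : acts_as p g -> (p x != x) <-> g (val x) <> val x.
  move=> /(_ x) <-; split=> [/eqP px /val_inj|px] //.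
  by apply/eqP => /(congr1 val).
have [|cardG card_moved] := finite_perm_bound T (group G_group) c c_gt0.
  move=> p /GP[g Pg pg]; apply: leq_card_finset val_inj _ (suppP g Pg) => x.
  by rewrite inE => /(movedE p g x pg).
split.
  have /choice[f fP] g : exists p, P g -> acts_as p g.
    have [/acts_exists[p pg]|nPg] := pselect (P g); first by exists p.
    by exists 1%g.
  apply: (card_le_finset _ _ f (group G_group)) cardG => [g h|g Pg]; last first.
    by apply/GP; exists g => //; apply: fP.
  (* Elements of [P] with the same action on the support are equal, since both fix every other
     point. *)
  rewrite !in_setE => Pg Ph eq_fgh; apply/sym_eqP => x.
  have [/mem_s sx|nx] := pselect (gsupp P x); last first.
    by rewrite !(gsupp_fixed _ P).
  by rewrite -(fP g Pg (Sub x sx)) -(fP h Ph (Sub x sx)) eq_fgh.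
set M := [set x : T | _]%SET in card_moved.
rewrite -card_le_II -(card_le_eql (card_eq_finset T M)) in card_moved.
apply: card_le_trans card_moved; apply: card_le_trans (card_image_le val _).
apply: subset_card_le => x Px; exists (Sub x (proj1 (mem_s x) Px)) => //=.
case: (Px) => g Pg gx; have [p pg] := acts_exists g Pg.
rewrite inE; apply/existsP; exists p; apply/andP; split.
  by apply/GP; exists g.
exact/(movedE p g _ pg).
Qed.

(** * Reduction to finite support *)

Lemma group_closed_support (Omega : Type) (P : set (Sym Omega))
    (X : set Omega) :
  group_closed [in P] -> group_closed [in P `&` [set g | supp g `<=` X]].
Proof.
move=> [/set_mem P1 Pdiv]; split; first by apply/mem_set; split.
move=> g h /set_mem[Pg gX] /set_mem[Ph hX]; apply/mem_set; split.
  by apply/set_mem/Pdiv; apply/mem_set.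
move=> x /=; apply: contra_notP => nXx.
have hx : h x = x by apply: contra_notP nXx => /hX.
have gx : g x = x by apply: contra_notP nXx => /gX.
by change (sym_inv h (g x) = x); rewrite gx -{1}hx sym_funK.
Qed.

Lemma card_le_finite_subsets (T : Type) (A : set T) (n : nat) :
  (forall B, finite_set B -> B `<=` A -> B #<= `I_n) -> A #<= `I_n.
Proof.
elim/Pchoice: T A => T A boundA.
(* An infinite [A] would contain a finite subset with more than [n] points. *)
have [finA|/(infinite_set_fset n.+1)[B BA ltnB]] := pselect (finite_set A).
  exact: boundA.
have cardB := introT (card_eq_fsetP (A := B)) (erefl _).
have := boundA _ _ BA; rewrite (eq_finite_set cardB) => /(_ (finite_II _)).
by rewrite (card_le_eql cardB) card_le_II leqNgt ltnB.
Qed.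

Theorem theorem3p1 (Omega : Type) (P : set (Sym Omega)) (c : nat) :
  group_closed [in P] ->
  (0 < c)%N ->
  (forall s : Sym Omega, P s -> supp s #<= `I_c) ->
  (P #<= `I_(c`!)) /\
  ((1 < c)%N -> gsupp P #<= `I_(2 * (c - 1))).
Proof.
move=> P_group c_gt0 suppP.
have gsupp_le : gsupp P #<= `I_(2 * (c - 1)).
  apply: card_le_finite_subsets => Y finY YP.
  (* For each point of [Y], choose an element of [P] moving it; the identity is a dummy value
     elsewhere. *)
  have /choice[f fP] y : exists g, Y y -> P g /\ supp g y.
    have [/YP[g Pg gy]|nYy] := pselect (Y y); first by exists g.
    by exists 1%g.
  pose X := \bigcup_(y in Y) supp (f y).
  pose Q := P `&` [set g | supp g `<=` X].
  have finX : finite_set X.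
    apply: bigcup_finite => // y /fP[Pfy _].
    exact: card_le_finite (suppP _ Pfy) (finite_II c).
  have QX : gsupp Q `<=` X by move=> x [g [_ gX] /gX].
  have YQ : Y `<=` gsupp Q.
    move=> y Yy; have [Pfy fy] := fP y Yy; exists (f y) => //; split=> //= x fx.
    by exists y.
  have [_ gsuppQ] := finite_gsupp_bound _ Q c
    (group_closed_support _ _ _ P_group) (sub_finite_set QX finX) c_gt0
    (fun g Qg => suppP g Qg.1).
  exact: card_le_trans (subset_card_le YQ) gsuppQ.
(* The support of [P] is now known to be finite, so the finite case bounds the order of [P]
   itself. *)
split=> //; have finP := card_le_finite gsupp_le (finite_II _).
by have [] := finite_gsupp_bound _ P c P_group finP c_gt0 suppP.
Qed.
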